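(* Let $X\subseteq\mathbb{R}^d$ be convex and let $g\colon\mathbb{R}^d\to\overline{\mathbb{R}}$ be a (Borel measurable) function. Let $$p^\star=\inf_{x\in X}g(x),\qquad p'=\inf_{\mu\in\mathcal{P}(X)}\mathbb{E}_{x'\sim\mu}\,g(x').$$ Let $\mathcal{I}=\{1,\dots,m\}$. If $\mu^\star=\sum_{i\in\mathcal{I}}\lambda_i\delta_{x_i}$ is a discrete probability measure (with $x_i\in X$, $\lambda_i\ge0$ for all $i\in\mathcal{I}$, and $\sum_{i\in\mathcal{I}}\lambda_i=1$) that solves $p'$, i.e., $\mathbb{E}_{x'\sim\mu^\star}g(x')=p'$, then $x^\star:=x_i$ solves $p^\star$, i.e., $g(x_i)=p^\star$, for all $i\in\mathcal{I}$ such that $\lambda_i>0$.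
   Context: $\overline{\mathbb{R}}=\mathbb{R}\cup\{-\infty,\infty\}$ denotes the extended real numbers. $\mathcal{P}(X)$ is the set of probability measures on $(X,\mathcal{B}(X))$, where $\mathcal{B}(X)$ is the Borel $\sigma$-algebra on $X$. $\delta_x$ is the Dirac measure centered at $x$, i.e., $\delta_x(A)=1$ if $x\in A$ and $\delta_x(A)=0$ if $x\notin A$, for $A\in\mathcal{B}(X)$. For Borel measurable $g$ and $\mu\in\mathcal{P}(X)$, $\mathbb{E}_{x'\sim\mu}g(x')=\int_X g(x')\,d\mu(x')$ is the expected value of $g$ with respect to $\mu$.
   Formalization: The formal theorem additionally assumes that p′ is not −∞; without this the claim fails, e.g. for X=ℝ, g(0)=−∞, g=0 elsewhere and μ*=(δ_0+δ_1)/2, where μ* solves p′=−∞ but g(1)=0≠p*. *)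

(* Defs.v *)
From HB Require Import structures.
From mathcomp Require Import all_boot all_order all_algebra.
From mathcomp Require Import all_classical all_reals all_analysis.
From mathcomp Require Import measurable_realfun.

Set Implicit Arguments.
Unset Strict Implicit.
Unset Printing Implicit Defensive.

Import Order.TTheory GRing.Theory Num.Theory.
Import numFieldNormedType.Exports.

Local Open Scope classical_set_scope.
Local Open Scope ring_scope.
Local Open Scope ereal_scope.

Definition borel (T : ptopologicalType) := g_sigma_algebraType (@open T).

(* The subset X as a space of its own, with the subspace topology.  Measurable
   types of the library are pointed, hence the proof that X is not empty; its
   choice of a point plays no role in the topology or in the sigma-algebra. *)
Definition subspaceType (T : topologicalType) (X : set T) of X !=set0 : Type :=
  set_type X.

Section subspaceType_instances.
Context (T : topologicalType) (X : set T) (X0 : X !=set0).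

HB.instance Definition _ := Topological.on (subspaceType X0).

HB.instance Definition _ := isPointed.Build (subspaceType X0)
  (exist _ (projT1 (cid X0)) (mem_set (projT2 (cid X0)))).

End subspaceType_instances.

(* X need not be a Borel subset of the ambient space. *)
Definition probability_on (R : realType) (T : topologicalType) (X : set T)
    (X0 : X !=set0) :=
  probability (borel (subspaceType X0)) R.

(* When the positive and the negative part of g both have an infinite integral,
   the library's integral is -oo.  This can only happen when g is not bounded
   below on X, and then inf_mean, bounded above by the values of g on X (Dirac
   measures), is -oo whatever the convention. *)
Definition mean (R : realType) (T : topologicalType) (X : set T)
    (X0 : X !=set0) (mu : probability_on R X0) (g : T -> \bar R) : \bar R :=
  \int[mu]_(x in [set: borel (subspaceType X0)]) g (set_val x).

Definition inf_value (R : realType) (T : Type) (X : set T) (g : T -> \bar R) :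
    \bar R :=
  ereal_inf [set g x | x in X].

Definition inf_mean (R : realType) (T : topologicalType) (X : set T)
    (X0 : X !=set0) (g : T -> \bar R) : \bar R :=
  ereal_inf [set mean mu g | mu in [set: probability_on R X0]].

(* Main.v *)
Require Import Defs.
From HB Require Import structures.
From mathcomp Require Import all_boot all_order all_algebra.
From mathcomp Require Import all_classical all_reals all_analysis.
From mathcomp Require Import measurable_realfun.
Import Order.TTheory GRing.Theory Num.Theory.
Import numFieldNormedType.Exports.
Local Open Scope classical_set_scope.
Local Open Scope ring_scope.
Local Open Scope ereal_scope.

(* Dirac measures show that inf_mean is a lower bound of g on X.  If it is a
   real number c, then g - c is nonnegative with integral 0 under mu, so g = c
   holds mu-almost everywhere, hence at every atom of mu. *)

(** It suffices to test open sets, which generate the Borel sigma-algebra; their preimages are open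
    by the definition of the subspace topology. *)
Lemma measurable_set_val {T : ptopologicalType} {X : set T} (X0 : X !=set0) :
  measurable_fun [set: borel (subspaceType X0)]
    (set_val : borel (subspaceType X0) -> borel T).
Proof.
apply: (@measurability _ _ (borel (subspaceType X0)) (borel T) _ _ (@open T)) => //.
move=> _ [U oU <-]; rewrite setTI; apply: sub_sigma_algebra.
by exists U.
Qed.

(** Splitting the integral of [f - c] requires [f] to be integrable, which follows from the lower
    bound and the finite value of the integral. *)
Lemma integral_eq_lower_bound_ae (R : realType) (d : measure_display)
    (T : measurableType d) (P : probability T R) (f : T -> \bar R) (c : R) :
  measurable_fun [set: T] f -> (forall y, c%:E <= f y) ->
  \int[P]_y f y = c%:E -> {ae P, forall y, f y = c%:E}.
Proof.
move=> mf cf intf.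
have mcst : measurable_fun [set: T] (cst c%:E) by exact: measurable_cst.
have icst : P.-integrable [set: T] (cst c%:E) by exact: finite_measure_integrable_cst.
(* From [c <= f] the negative part is at most [|c|], integrable under a finite measure. *)
have neg_lty : \int[P]_y f^\- y < +oo.
  apply: (@le_lt_trans _ _ (\int[P]_y `|cst c%:E y|)); last first.
    by case/integrableP: icst.
  apply: ge0_le_integral => //; first exact: measurable_funeneg.
  move=> y _; rewrite funenegE ge_max abse_ge0 andbT.
  by rewrite leeNl (le_trans _ (cf y))// leeNl -abseN lee_abs.
(* The integral [c] is the difference of those of the two parts; with the second finite, the first
   cannot be [+oo]. *)
have pos_lty : \int[P]_y f^\+ y < +oo.
  move: intf neg_lty; rewrite integralE.
  have : 0 <= \int[P]_y f^\- y by exact: integral_ge0.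
  by case: (\int[P]_y f^\+ y) => [?||];
    case: (\int[P]_y f^\- y) => [?||] //= *; rewrite ltry.
have intgf : P.-integrable [set: T] f.
  apply/integrableP; split => //.
  rewrite (_ : (fun y => `|f y|) = f^\+ \+ f^\-); last by rewrite -fune_abse.
  rewrite ge0_integralD//; [exact: lte_add_pinfty|exact: measurable_funepos|exact: measurable_funeneg].
have f_ge y : 0 <= f y - c%:E by rewrite sube_ge0.
have : \int[P]_y `|f y - c%:E| = 0.
  under eq_integral do rewrite gee0_abs//.
  rewrite (@integralB _ _ _ P _ _ f (cst c%:E))//= intf.
  by rewrite integral_cst// (_ : _ [set: T] = 1) ?mule1 ?subee//; exact: probability_setT.
move/(ae_eq_integral_abs P measurableT (emeasurable_funB mf mcst)).
(* An infinite [f y] is ruled out too: subtracting the real [c] would leave it infinite, not 0. *)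
by apply: filterS => y /(_ I); case: (f y) => //= r [] /subr0_eq ->.
Qed.

Lemma measurable_comp_set_val (R : realType) (T : ptopologicalType) (X : set T)
    (X0 : X !=set0) (g : T -> \bar R) :
  measurable_fun [set: borel T] g ->
  measurable_fun [set: borel (subspaceType X0)] (fun y => g (set_val y)).
Proof. by move=> mg; exact: (measurableT_comp mg (measurable_set_val X0)). Qed.

Lemma inf_mean_le_value (R : realType) (T : ptopologicalType) (X : set T)
    (X0 : X !=set0) (g : T -> \bar R) (y : borel (subspaceType X0)) :
  measurable_fun [set: borel T] g -> inf_mean X0 g <= g (set_val y).
Proof.
move=> mg; apply: ereal_inf_lbound; exists (\d_y : probability_on R X0) => //.
rewrite /mean integral_dirac//; last exact: measurable_comp_set_val.
by rewrite diracT mul1e.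
Qed.

Theorem proposition2 (R : realType) (d : nat)
    (X : set 'rV[R]_d) (X0 : X !=set0) (X_convex : convex_set X)
    (g : 'rV[R]_d -> \bar R)
    (g_meas : measurable_fun [set: borel 'rV[R]_d] g)
    (m : nat) (x : 'I_m -> borel (subspaceType X0)) (lambda : 'I_m -> R)
    (lambda_ge0 : forall i, (0 <= lambda i)%R)
    (lambda_sum1 : (\sum_(i < m) lambda i = 1)%R)
    (mu : probability_on R X0)
    (mu_discrete : forall A : set (borel (subspaceType X0)), measurable A ->
       mu A = \sum_(i < m) (lambda i)%:E * \d_(x i) A)
    (inf_mean_proper : inf_mean X0 g != -oo)
    (mu_solves : mean mu g = inf_mean X0 g) :
  forall i : 'I_m, (0 < lambda i)%R -> g (set_val (x i)) = inf_value X g.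
Proof.
move=> i li_gt0.
have inf_mean_le (z : 'rV[R]_d) : X z -> inf_mean X0 g <= g z.
  by move=> Xz; apply: (@inf_mean_le_value _ _ _ _ _ (exist _ z (mem_set Xz))).
have Xx j : X (set_val (x j)) by exact: set_valP.
apply/eqP; rewrite eq_le; apply/andP; split; last first.
  by apply: ereal_inf_lbound; exists (set_val (x i)).
apply: (@le_trans _ _ (inf_mean X0 g)); last first.
  by apply: le_ereal_inf_tmp => _ [z Xz <-]; exact: inf_mean_le.
(* The value [-oo] must be excluded: one atom of positive weight where [g] is [-oo] brings the mean
   down to [-oo], whatever [g] is at the other atoms. *)
case Ec : (inf_mean X0 g) => [c||]; [|exact: leey|by move: inf_mean_proper; rewrite Ec].
(* [B] is a measurable null set containing all exceptional points; measurability lets [mu_discrete]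
   apply to it. *)
have [B [mB muB0 subB]] : {ae mu, forall y, g (set_val y) = c%:E}.
  apply: integral_eq_lower_bound_ae.
  - exact: measurable_comp_set_val.
  - by move=> y; rewrite -Ec; apply: inf_mean_le; exact: set_valP.
  - by rewrite -Ec -mu_solves.
have [gxi|/subB Bxi] := pselect (g (set_val (x i)) = c%:E); first by rewrite gxi.
suff : 0 < mu B by rewrite muB0 ltxx.
(* As [x i] lies in [B], its term in the sum is [lambda i]; the others are nonnegative, so [mu B] is
   at least [lambda i]. *)
rewrite mu_discrete// (bigD1 i)//= diracE mem_set// mule1.
rewrite (@lt_le_trans _ _ (lambda i)%:E) ?lte_fin// leeDl// sume_ge0// => j _.
by rewrite mule_ge0 ?lee_fin.
Qed.
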